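(* Let $(\sigma_n)_{n\ge 1}$ be a sequence of positive real numbers, and consider the time-dependent Pólya urn with reinforcement sequence $(\sigma_n)$, with $T_0$ initial white balls and $\tau_0$ initial balls in total, where $\tau_n=\tau_0+\sum_{i=1}^n\sigma_i$. Let $\Theta_n$ be the proportion of white balls at time $n$ and $\Theta$ its almost sure limit. For $n\ge 0$ put $$\delta_n=\sum_{i=n+1}^{\infty}\Big(\frac{\sigma_i}{\tau_i}\Big)^2\in(0,\infty].$$ Suppose that $$\limsup_{n\to\infty}\frac{\Theta_n}{\delta_n}=\infty$$ almost surely. Then $\mathbb{P}(\Theta=0)=0$.
   Context: Time-dependent Pólya urn: let $(\sigma_n)_{n\ge1}$ be a deterministic sequence of positive real numbers (not necessarily integers), let $\tau_0$ (initial total number of balls) and $T_0$ (initial number of white balls) be deterministic integers with $1\le T_0\le \tau_0-1$ (at least one white and one black ball initially), and set $\tau_n=\tau_0+\sum_{i=1}^n\sigma_i$ for $n\ge 0$. The random processes $(I_n)_{n\ge1}$, $(T_n)_{n\ge 0}$, $(\Theta_n)_{n\ge 0}$ are defined recursively on a probability space by $\Theta_n=T_n/\tau_n$ and $T_{n+1}=T_n+\sigma_{n+1}I_{n+1}$, where, conditionally on $\mathcal{F}_n=\sigma(I_1,\dots,I_n)$ (the generated $\sigma$-algebra), $I_{n+1}$ is a Bernoulli random variable with parameter $\Theta_n$, i.e. $I_{n+1}\in\{0,1\}$ and $\mathbb{P}(I_{n+1}=1\mid\mathcal{F}_n)=\Theta_n$. The process $(\Theta_n)$ is a bounded martingale and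 hence converges almost surely to a random variable denoted $\Theta$. Convention: $\Theta_n/\delta_n=0$ if $\delta_n=\infty$. *)

(* Defs.v *)
From HB Require Import structures.
From mathcomp Require Export all_boot all_order all_algebra.
From mathcomp Require Export all_classical all_reals all_analysis.

Set Implicit Arguments.
Unset Strict Implicit.
Unset Printing Implicit Defensive.

Import Order.TTheory GRing.Theory Num.Theory.
Import numFieldNormedType.Exports.

Local Open Scope classical_set_scope.
Local Open Scope ring_scope.

(* [Y] is a version of the conditional probability of [E] given the
   sub-sigma-algebra [F]. *)
Definition is_cond_prob d (Omega : measurableType d) (R : realType)
    (P : probability Omega R) (F : set (set Omega)) (E : set Omega)
    (Y : Omega -> R) : Prop :=
  [/\ forall B : set R, measurable B -> F (Y @^-1` B),
      P.-integrable setT (EFin \o Y) &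
      forall A, F A -> (\int[P]_(w in A) (Y w)%:E = P (A `&` E))%E].

(* In all the sequences [sigma] and [I] below, the term of index 0 is not
   used: the mathematical sequences start at 1. *)

(* Sigma-algebra generated by I_1, ..., I_n. *)
Definition history d (Omega : measurableType d) (R : realType)
    (I : nat -> Omega -> R) (n : nat) : set (set Omega) :=
  <<s \bigcup_(i in [set i | (1 <= i <= n)%N])
        preimage_set_system setT (I i) measurable >>.

Definition total_balls (R : realType) (sigma : nat -> R) (tau0 n : nat) : R :=
  tau0%:R + \sum_(1 <= i < n.+1) sigma i.

Fixpoint white_balls (Omega : Type) (R : realType) (sigma : nat -> R)
    (T0 : nat) (I : nat -> Omega -> R) (n : nat) (w : Omega) : R :=
  if n is m.+1 then white_balls sigma T0 I m w + sigma m.+1 * I m.+1 w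
  else T0%:R.

Definition white_proportion (Omega : Type) (R : realType) (sigma : nat -> R)
    (tau0 T0 : nat) (I : nat -> Omega -> R) (n : nat) (w : Omega) : R :=
  white_balls sigma T0 I n w / total_balls sigma tau0 n.

Record polya_urn d (Omega : measurableType d) (R : realType)
    (P : probability Omega R) (sigma : nat -> R) (tau0 T0 : nat)
    (I : nat -> {RV P >-> R}) : Prop := PolyaUrn {
  urn_sigma_gt0 : forall n, (1 <= n)%N -> 0 < sigma n;
  urn_initial : (1 <= T0 <= tau0 - 1)%N;
  urn_draw01 : forall n, (1 <= n)%N ->
    {ae P, forall w, I n w = 0 \/ I n w = 1};
  urn_draw_cond : forall n,
    is_cond_prob P (history I n) [set w | I n.+1 w = 1]
      (white_proportion sigma tau0 T0 I n) }.

(* Tail sums, possibly infinite. *)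
Definition delta (R : realType) (sigma : nat -> R) (tau0 n : nat) : \bar R :=
  (\sum_(n.+1 <= i <oo) ((sigma i / total_balls sigma tau0 i) ^+ 2)%:E)%E.

(* Main.v *)
(* Given n draws leading to the proportion theta, the increments of the
   martingale have conditional second moments at most s_i^2 theta with
   s_i = sigma_i / tau_i, so E[(Theta - theta)^2 | F_n] <= theta delta_n and,
   by Chebyshev, P(Theta = 0 | F_n) <= delta_n / theta. Stopping the urn at the
   first n with Theta_n > K delta_n, a time which is almost surely finite, gives
   P(Theta = 0) <= 1 / K for every K > 0. Since the draws take two values,
   conditioning on F_n amounts to conditioning on the words of length n over
   {0, 1}, and no general conditional expectation is needed. *)
Require Import Defs.
From HB Require Import structures.
From mathcomp Require Import all_boot all_order all_algebra.
From mathcomp Require Import all_classical all_reals all_analysis.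
From mathcomp Require Import measurable_realfun ring lra.

Import Order.TTheory GRing.Theory Num.Theory.
Import numFieldNormedType.Exports.

Local Open Scope classical_set_scope.
Local Open Scope ring_scope.

Lemma limn_esup_le (R : realType) (u : (\bar R)^nat) (M : \bar R) :
  (forall n, u n <= M)%E -> (limn_esup u <= M)%E.
Proof.
move=> uM; rewrite /limn_esup limf_esupE.
apply: (@le_trans _ _ (ereal_sup (u @` setT))).
  by apply: ereal_inf_lbound; exists setT => //; exact: filterT.
by apply: ge_ereal_sup => _ [n _ <-].
Qed.

(** * Words of draws and their cylinders *)

Section Urn.
Context {d : measure_display} {Omega : measurableType d} {R : realType}.
Context {P : probability Omega R} {sigma : nat -> R} {tau0 T0 : nat}.
Context {I : nat -> {RV P >-> R}} (urn : polya_urn sigma tau0 T0 I).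

Local Notation total := (total_balls sigma tau0).
Local Notation theta := (white_proportion sigma tau0 T0 I).
Local Notation step i := (sigma i / total i).

(* The head of a word is the most recent draw. *)
Fixpoint cylinder (v : seq bool) : set Omega :=
  if v is b :: u then cylinder u `&` [set w | I (size v) w = b%:R] else setT.

Fixpoint white_along (v : seq bool) : R :=
  if v is b :: u then white_along u + sigma (size v) * b%:R else T0%:R.

Definition proportion_along v := white_along v / total (size v).

Lemma total_ballsS n : total n.+1 = total n + sigma n.+1.
Proof. by rewrite /total_balls big_nat_recr//= addrA. Qed.

Lemma total_balls_gt0 n : 0 < total n.
Proof.
elim: n => [|n IHn]; last by rewrite total_ballsS addr_gt0// (urn_sigma_gt0 urn).
rewrite /total_balls big_geq// addr0 ltr0n.
by have := urn_initial urn; case: tau0 => // /andP[]; case: T0.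
Qed.

Lemma white_along_gt0 v : 0 < white_along v.
Proof.
elim: v => [|b u IHu] /=; first by rewrite ltr0n; have /andP[] := urn_initial urn.
by rewrite ltr_wpDr// mulr_ge0// ltW// (urn_sigma_gt0 urn).
Qed.

Lemma proportion_along_gt0 v : 0 < proportion_along v.
Proof. by rewrite divr_gt0 ?white_along_gt0 ?total_balls_gt0. Qed.

(** The martingale increment as a centred draw scaled by [step]; its conditional mean zero and its
    variance are read off this form. *)
Lemma proportion_along_cons b v :
  proportion_along (b :: v) =
  proportion_along v + step (size v).+1 * (b%:R - proportion_along v).
Proof.
rewrite /proportion_along /=.
have t0 := total_balls_gt0 (size v).
have := total_balls_gt0 (size v).+1; rewrite total_ballsS => t1.
by field; rewrite !gt_eqF.
Qed.

Lemma white_balls_cylinder v w : cylinder v w ->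
  white_balls sigma T0 I (size v) w = white_along v.
Proof. by elim: v => //= b u IHu [/IHu -> ->]. Qed.

Lemma white_proportion_cylinder v w : cylinder v w ->
  theta (size v) w = proportion_along v.
Proof. by move=> vw; rewrite /white_proportion white_balls_cylinder. Qed.

Lemma measurable_cylinder v : measurable (cylinder v).
Proof.
elim: v => [|b u IHu] /=; first exact: measurableT.
apply: measurableI => //.
rewrite -[X in measurable X]setTI.
exact: (measurable_funPT (I (size u).+1) measurableT _ (measurable_set1 b%:R)).
Qed.

Lemma measurable_white_proportion n : measurable_fun setT (theta n).
Proof.
apply: measurable_funM => //.
elim: n => [|n IHn] /=; first exact: measurable_cst.
by apply: measurable_funD => //; apply: measurable_funM.
Qed.

(** This makes [cylinder v] an event against which [urn_draw_cond] can be tested. *)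
Lemma history_cylinder v n : (size v <= n)%N -> history I n (cylinder v).
Proof.
elim: v n => [|b u IHu] n /= un.
  exact: (@measurableT _ (g_sigma_algebraType
    (\bigcup_(i in [set i | (1 <= i <= n)%N])
        preimage_set_system setT (I i) measurable))).
apply: (@measurableI _ (g_sigma_algebraType
    (\bigcup_(i in [set i | (1 <= i <= n)%N])
        preimage_set_system setT (I i) measurable)) _ _ (IHu _ (ltnW un))).
apply: sub_sigma_algebra; exists (size u).+1 => //=.
by exists [set b%:R] => //; rewrite setTI.
Qed.

(** * Law of the next draw on a cylinder *)

Lemma measure_cylinder_true v :
  P (cylinder (true :: v)) = ((proportion_along v)%:E * P (cylinder v))%E.
Proof.
have [_ _ /(_ _ (history_cylinder v _ (leqnn _))) /= <-] :=
  urn_draw_cond urn (size v).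
rewrite -integral_cst; last exact: measurable_cylinder.
by apply: eq_integral => w /[!inE] vw; rewrite /= white_proportion_cylinder.
Qed.

Lemma integral_cylinder v (f : Omega -> \bar R) :
  measurable_fun setT f -> (forall w, 0 <= f w)%E ->
  (\int[P]_(w in cylinder v) f w =
   \int[P]_(w in cylinder (true :: v)) f w +
   \int[P]_(w in cylinder (false :: v)) f w)%E.
Proof.
move=> mf f0.
(* A draw is 0 or 1 only almost surely, so the two children fill the cylinder up to the null set
   [N], which is removed from both domains. *)
have [N [mN PN0 subN]] := urn_draw01 urn (ltn0Sn (size v)).
have mC u : measurable (cylinder u) := measurable_cylinder u.
have mf' D : measurable_fun D f by exact: measurable_funTS.
rewrite -ge0_integral_setU//; last first.
  rewrite disj_set2E; apply/eqP/seteqP; split => // w [[_ /= ->] [_ /eqP]].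
  by rewrite oner_eq0.
have mU := measurableU _ _ (mC (true :: v)) (mC (false :: v)).
rewrite (ge0_negligible_integral mN (mC v))//.
rewrite [RHS](ge0_negligible_integral mN mU)//.
congr (integral _ _ _); apply/seteqP; split => w /=; last by tauto.
move=> [vw Nw]; split => //.
have [I0|I1] : I (size v).+1 w = 0 \/ I (size v).+1 w = 1.
  by apply: contrapT => /subN.
- by right; split.
- by left; split.
Qed.

Lemma measure_setI_cylinder (B : set Omega) v : measurable B ->
  (P (B `&` cylinder v) =
   P (B `&` cylinder (true :: v)) + P (B `&` cylinder (false :: v)))%E.
Proof.
move=> mB; have mC u := measurable_cylinder u.
have := integral_cylinder v (EFin \o \1_B).
rewrite !integral_indic; do ?exact: mC; do ?exact: mB.
by apply => [|w]; [exact/measurable_EFinP|rewrite lee_fin].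
Qed.

Lemma fin_num_cylinder v : P (cylinder v) \is a fin_num.
Proof. exact/fin_num_measure/measurable_cylinder. Qed.

(** [urn_draw_cond] gives the probability of a 1 only; that of a 0 follows by additivity over the
    two children. *)
Lemma measure_cylinder_false v :
  P (cylinder (false :: v)) = ((1 - proportion_along v)%:E * P (cylinder v))%E.
Proof.
have := measure_setI_cylinder setT v measurableT; rewrite !setTI.
rewrite measure_cylinder_true -(fineK (fin_num_cylinder v)).
rewrite -(fineK (fin_num_cylinder (false :: v))) -!EFinM -EFinD => -[vE].
by congr EFin; rewrite mulrBl mul1r {1}vE addrAC subrr add0r.
Qed.

(** * Second moments and Chebyshev's inequality *)

(* Backward induction along the tree of draws: a single draw adds to the
   second moment the conditional variance s^2 theta (1 - theta), which is at
   most s^2 theta. *)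
Lemma integral_cylinder_sqr v k c :
  (\int[P]_(w in cylinder v) ((theta (size v + k) w - c) ^+ 2)%:E <=
   ((proportion_along v - c) ^+ 2 + proportion_along v *
      \sum_((size v).+1 <= i < (size v + k).+1) step i ^+ 2)%:E *
   P (cylinder v))%E.
Proof.
elim: k v => [|k IHk] v.
  rewrite addn0 big_geq// mulr0 addr0 -integral_cst; last first.
    exact: measurable_cylinder.
  rewrite le_eqVlt; apply/predU1P; left; apply: eq_integral => w /[!inE] vw.
  by rewrite /= white_proportion_cylinder.
rewrite integral_cylinder; last 2 first.
- apply/measurable_EFinP/measurable_funX/measurable_funB => //.
  exact: measurable_white_proportion.
- by move=> w; rewrite lee_fin sqr_ge0.
rewrite big_ltn ?ltnS -?addSnnS ?leq_addr//.
apply: (le_trans (leeD (IHk (true :: v)) (IHk (false :: v)))) => /=.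
rewrite -/(cylinder (true :: v)) -/(cylinder (false :: v)).
rewrite measure_cylinder_true measure_cylinder_false !proportion_along_cons /=.
have p0 : 0 <= fine (P (cylinder v)) by rewrite fine_ge0.
have := proportion_along_gt0 v.
rewrite -(fineK (fin_num_cylinder v)) -!EFinM -EFinD lee_fin.
move: (fine _) p0 (proportion_along v) (step _) (\sum_(_ <= i < _) _).
move=> p p0 t s D t0; rewrite -subr_ge0.
(* The terms linear in [s] cancel by the martingale property; what remains is the gap between
   [s^2 t] and the variance [s^2 t (1 - t)]. *)
rewrite [leRHS](_ : _ = p * (t * s) ^+ 2); last by ring.
by rewrite mulr_ge0// sqr_ge0.
Qed.

Lemma delta_ge n k :
  ((\sum_(n.+1 <= i < k) step i ^+ 2)%:E <= delta sigma tau0 n)%E.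
Proof.
by rewrite -sumEFin; apply: nneseries_lim_ge => i _ _; rewrite lee_fin sqr_ge0.
Qed.

(* Fatou's lemma replaces L^2 convergence: on A the integrand
   (Theta_k - t)^2 tends to t^2. *)
Lemma measure_cylinder_cvg0 v (A : set Omega) (K : R) : measurable A ->
  (forall w, A w -> theta n w @[n --> \oo] --> 0) -> 0 < K ->
  (K%:E * delta sigma tau0 (size v) < (proportion_along v)%:E)%E ->
  (P (A `&` cylinder v) <= K^-1%:E * P (cylinder v))%E.
Proof.
move=> mA A0 K0; set t := proportion_along v; set D := delta _ _ _ => tK.
have mC := measurable_cylinder v.
have mAC : measurable (A `&` cylinder v) by exact: measurableI.
have t0 : 0 < t := proportion_along_gt0 v.
have D0 : (0 <= D)%E.
  by apply: le_trans (delta_ge (size v) 0); rewrite lee_fin big_geq.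
have Dfin : D \is a fin_num.
  (* If [D] were infinite, [K D] would be too and could not lie below [t]. *)
  rewrite ge0_fin_numE//; apply: contraTlt tK.
  by rewrite leye_eq => /eqP ->; rewrite gt0_muley ?lte_fin// -leNgt leey.
pose f k w := ((theta (size v + k) w - t) ^+ 2)%:E.
have mf k : measurable_fun setT (f k).
  apply/measurable_EFinP/measurable_funX/measurable_funB => //.
  exact: measurable_white_proportion.
have f0 k w : (0 <= f k w)%E by rewrite lee_fin sqr_ge0.
have bound k : (\int[P]_(w in A `&` cylinder v) f k w <=
    (t * fine D)%:E * P (cylinder v))%E.
  apply: (@le_trans _ _ (\int[P]_(w in cylinder v) f k w)%E).
    by apply: ge0_subset_integral => //; exact: measurable_funTS.
  apply: (le_trans (integral_cylinder_sqr v k t)).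
  rewrite lee_wpmul2r// subrr expr0n add0r lee_fin ler_wpM2l ?(ltW t0)//.
  by rewrite -lee_fin fineK// delta_ge.
have : ((t ^+ 2)%:E * P (A `&` cylinder v) <=
    (t * fine D)%:E * P (cylinder v))%E.
  rewrite -integral_cst//.
  apply: (@le_trans _ _
    (\int[P]_(w in A `&` cylinder v) limn_einf (f^~ w))%E).
    rewrite le_eqVlt; apply/predU1P; left; apply: eq_integral => w /[!inE] -[Aw _].
    have /cvg_limn_einf_sup[-> _]// : f k w @[k --> \oo] --> (t ^+ 2)%:E.
    apply: cvg_EFin; first exact: nearW.
    have cvg_t : theta (size v + k) w - t @[k --> \oo] --> 0 - t.
      apply: cvgB; last exact: cvg_cst.
      exact: (cvg_comp _ (fun n => theta n w) (cvg_addnl (size v)) (A0 w Aw)).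
    by rewrite -sqrrN -sub0r expr2; exact: (cvgM cvg_t cvg_t).
  apply: (le_trans (fatou P mAC _ _)) => //.
    by move=> k; exact: measurable_funTS.
  apply: (le_trans (limn_einf_sup _)).
  exact: limn_esup_le.
have fC := fin_num_cylinder v.
have fA : P (A `&` cylinder v) \is a fin_num by exact: fin_num_measure.
have p0 : 0 <= fine (P (cylinder v)) by rewrite fine_ge0.
move: tK; rewrite -(fineK fC) -(fineK fA) -(fineK Dfin) -!EFinM lte_fin !lee_fin.
move: (fine _) (fine _) (fine _) p0; clearbody t => q D' p p0 tK /= tpq.
rewrite mulrC ler_pdivlMr// -(ler_pM2l t0).
(* With [q] and [p] the two probabilities, [K D' < t] then gives [K t q <= K D' p <= t p]. *)
have tq : t * q <= D' * p by rewrite -(ler_pM2l t0); lra.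
have := ler_wpM2r (ltW K0) tq; have := ler_wpM2r p0 (ltW tK); lra.
Qed.

(** * First passage above [K] times [delta] *)

Definition dominates (K : R) (n : nat) : set Omega :=
  [set w | (K%:E * delta sigma tau0 n < (theta n w)%:E)%E].

Lemma measurable_dominates K n : measurable (dominates K n).
Proof.
rewrite /dominates -[X in measurable X]setTI.
apply: emeasurable_fun_o_infty => //.
exact/measurable_EFinP/measurable_white_proportion.
Qed.

Lemma measurable_dominates_upto K n N :
  measurable (\bigcup_(k in `I_N) dominates K (n + k)).
Proof. by apply: bigcup_measurable => k _; exact: measurable_dominates. Qed.

(* The first passage decomposition: the tree of draws is cut at every word at
   which the proportion first exceeds K delta. *)
Lemma measure_cylinder_dominates v N (A : set Omega) (K : R) : measurable A ->
  (forall w, A w -> theta n w @[n --> \oo] --> 0) -> 0 < K ->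
  (P (A `&` (\bigcup_(k in `I_N) dominates K (size v + k)) `&` cylinder v) <=
   K^-1%:E * P (cylinder v))%E.
Proof.
move=> mA A0 K0; have mC u := measurable_cylinder u.
have mB n M : measurable (A `&` \bigcup_(k in `I_M) dominates K (n + k)).
  by apply: measurableI => //; exact: measurable_dominates_upto.
elim: N v => [|N IHN] v.
  rewrite (_ : `I_0 = set0) ?II0// bigcup_set0 setI0 set0I measure0.
  by rewrite mule_ge0// lee_fin invr_ge0 ltW.
have [good|bad] := ltP (K%:E * delta sigma tau0 (size v))%E
                       (proportion_along v)%:E.
  apply: le_trans (measure_cylinder_cvg0 v A K mA A0 K0 good).
  by apply: le_measure; rewrite ?inE; [exact: measurableI..|]; apply: setSI.
(* The proportion is constant on the cylinder of [v], so [bad] excludes [k = 0]; the later times are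
   counted from the child instead. *)
have sub b : A `&` (\bigcup_(k in `I_N.+1) dominates K (size v + k)) `&`
      cylinder (b :: v) `<=`
    A `&` (\bigcup_(k in `I_N) dominates K (size (b :: v) + k)) `&`
      cylinder (b :: v).
  move=> w [[Aw [[|k] /= kN wk]] [vw Iw]]; last first.
    by split => //; split => //; exists k => //; rewrite addSnnS.
  move: wk; rewrite /dominates /= addn0 white_proportion_cylinder//.
  by rewrite ltNge bad.
have bound b : (P (A `&` (\bigcup_(k in `I_N.+1) dominates K (size v + k)) `&`
      cylinder (b :: v)) <= K^-1%:E * P (cylinder (b :: v)))%E.
  apply: le_trans (IHN (b :: v)).
  by apply: le_measure (sub b); rewrite inE; exact: measurableI.
rewrite measure_setI_cylinder//.
apply: (le_trans (leeD (bound true) (bound false))).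
by rewrite -ge0_muleDr// -[X in (_ * P X)%E]setTI measure_setI_cylinder// !setTI.
Qed.

Lemma delta_gt0 n : (0 < delta sigma tau0 n)%E.
Proof.
apply: lt_le_trans (delta_ge n n.+2); rewrite big_nat1 lte_fin exprn_gt0//.
by rewrite divr_gt0 ?total_balls_gt0// (urn_sigma_gt0 urn).
Qed.

Lemma limn_esup_dominates w K : 0 < K ->
  limn_esup (fun n => ((theta n w)%:E / delta sigma tau0 n)%E) = +oo%E ->
  exists n, dominates K n w.
Proof.
move=> K0 limsup_oo; apply: contrapT => /forallNP nK.
suff: (limn_esup (fun n => ((theta n w)%:E / delta sigma tau0 n)%E) <= K%:E)%E.
  by rewrite limsup_oo.
apply: limn_esup_le => n; have := nK n; have := delta_gt0 n.
rewrite /dominates /= => + /negP; rewrite -leNgt.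
(* Positivity of [delta] excludes 0 and [-oo]; at [+oo] the quotient is 0, hence below [K]. *)
case: inveP => [|_ _|//|r _]; first by rewrite ltxx.
  by rewrite mule0 lee_fin ltW.
by rewrite lte_fin -!EFinM !lee_fin => r0 thetaK; rewrite ler_pdivrMr.
Qed.

(** The bound for passage before time [N] is uniform in [N], so it survives continuity from
    below. *)
Lemma measure_cvg0_dominates (A : set Omega) (K : R) : measurable A ->
  (forall w, A w -> theta n w @[n --> \oo] --> 0) -> 0 < K ->
  A `<=` \bigcup_n dominates K n -> (P A <= K^-1%:E)%E.
Proof.
move=> mA A0 K0 AK.
pose F N := A `&` \bigcup_(k in `I_N) dominates K k.
have mF N : measurable (F N).
  by apply: measurableI => //; exact: (measurable_dominates_upto K 0).
have UF : \bigcup_N F N = A.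
  apply/seteqP; split => [w [N _ [Aw _]]//|w Aw].
  have [n _ nw] := AK _ Aw; exists n.+1 => //; split => //; exists n => //=.
have := @nondecreasing_cvg_mu _ _ _ P F mF.
rewrite UF => /(_ mA) PF; have {PF} : P \o F @ \oo --> P A.
  apply: PF => M N MN; apply/subsetPset; apply: setIS => w [k /= kM kw].
  by exists k => //=; exact: leq_trans MN.
move=> PF; rewrite -(cvg_lim _ PF)//; apply: lime_le.
  by apply/cvg_ex; exists (P A).
apply: nearW => N.
(* The empty word is the root of the tree: its cylinder has probability 1. *)
have := measure_cylinder_dominates [::] N A K mA A0 K0.
by rewrite /= setIT probability_setT mule1.
Qed.

End Urn.

(* The inverse of +oo in \bar R is 0, so the quotient below is 0 when
   delta sigma tau0 n = +oo. *)
Theorem proposition2p3 (d : measure_display) (Omega : measurableType d)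
    (R : realType) (P : probability Omega R)
    (sigma : nat -> R) (tau0 T0 : nat) (I : nat -> {RV P >-> R})
    (urn : polya_urn sigma tau0 T0 I)
    (Theta : {RV P >-> R})
    (Theta_lim : {ae P, forall w,
       white_proportion sigma tau0 T0 I n w @[n --> \oo] --> Theta w})
    (limsup_oo : {ae P, forall w,
       limn_esup (fun n =>
         ((white_proportion sigma tau0 T0 I n w)%:E / delta sigma tau0 n)%E)
       = +oo%E}) :
  P [set w | Theta w = 0] = 0%E.
Proof.
have [N [mN PN0 subN]] : {ae P, forall w,
    white_proportion sigma tau0 T0 I n w @[n --> \oo] --> Theta w /\
    limn_esup (fun n =>
       ((white_proportion sigma tau0 T0 I n w)%:E / delta sigma tau0 n)%E)
     = +oo%E} by apply: filterS2 Theta_lim limsup_oo.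
have mZ : measurable [set w | Theta w = 0].
  rewrite -[X in measurable X]setTI.
  exact: (measurable_funPT Theta measurableT _ (measurable_set1 0)).
have offN w : ([set w | Theta w = 0] `\` N) w ->
    Theta w = 0 /\
    (white_proportion sigma tau0 T0 I n w @[n --> \oo] --> Theta w /\
    limn_esup (fun n =>
       ((white_proportion sigma tau0 T0 I n w)%:E / delta sigma tau0 n)%E)
     = +oo%E).
  by move=> [/= Theta0 Nw]; split => //; apply: contrapT => /subN.
apply/eqP; rewrite eq_le measure_ge0 andbT.
rewrite (measureDI P mZ mN) [X in (_ + X)%E](_ : _ = 0%E); last first.
  by apply: subset_measure0 PN0 => //; exact: measurableI.
rewrite adde0; apply/lee_addgt0Pr => e e0.
(* The choice [K = e^-1] turns the bound [K^-1] into [e]. *)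
rewrite add0e -[e]invrK; apply: (measure_cvg0_dominates urn).
- exact: measurableD.
- by move=> w /offN[<- []].
- by rewrite invr_gt0.
- move=> w /offN[_ [_ woo]].
  have einv : 0 < e^-1 by rewrite invr_gt0.
  by have [n] := limn_esup_dominates urn w _ einv woo; exists n.
Qed.
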